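(* Let $q$ be a power of a prime $p\ge5$. Then $\Theta_{\rm b}=27+\mathcal A$, where \[ \mathcal A=\Bigl\{\Bigl(\frac{\mu(\mu^2-9)}{\mu^2-1}\Bigr)^2:\ \mu\in\mathbb F_q\setminus\{0,\pm1,\pm3\}\Bigr\}. \]
   Context: $\mathbb F_q$ is the field with $q$ elements. Let $\Omega=\{(s,t)\in\mathbb F_q^2: t(1+s+t)\neq0\}$. For $(s,t)\in\Omega$ let $G_{s,t}(X)=X^4-2X^3-sX^2-2tX+t$ and $\theta(s,t)=\frac{s^3}{t(1+s+t)}$. Define $\Theta_{\rm b}=\{\theta(s,t):(s,t)\in\Omega,\ G_{s,t}\ \text{is a product of two different monic irreducible quadratics over}\ \mathbb F_q\}$. *)

(* Defs.v *)
From mathcomp Require Import all_boot all_order all_algebra.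
From mathcomp Require Import boolp classical_sets.

Set Implicit Arguments.
Unset Strict Implicit.
Unset Printing Implicit Defensive.

Import GRing.Theory.
Local Open Scope ring_scope.
Local Open Scope classical_set_scope.

Definition Omega (F : finFieldType) : set (F * F) :=
  [set st : F * F | st.2 * (1 + st.1 + st.2) != 0].
Arguments Omega F : clear implicits.

Definition Gpoly (F : finFieldType) (s t : F) : {poly F} :=
  'X^4 - 2%:R *: 'X^3 - s *: 'X^2 - (2%:R * t) *: 'X + t%:P.

Definition theta (F : finFieldType) (s t : F) : F :=
  s ^+ 3 / (t * (1 + s + t)).

Definition monic_irreducible_quadratic (F : finFieldType) (p : {poly F}) : Prop :=
  [/\ p \is monic, size p = 3%N & irreducible_poly p].

Definition product_of_two_distinct_quadratics (F : finFieldType)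
    (g : {poly F}) : Prop :=
  exists p1 p2 : {poly F},
    [/\ monic_irreducible_quadratic p1, monic_irreducible_quadratic p2,
        p1 != p2 & g = p1 * p2].

Definition Theta_b (F : finFieldType) : set F :=
  [set theta st.1 st.2 | st in
     [set st : F * F | Omega F st /\
        product_of_two_distinct_quadratics (Gpoly st.1 st.2)]].

Definition calA (F : finFieldType) : set F :=
  [set (mu * (mu ^+ 2 - 9%:R) / (mu ^+ 2 - 1)) ^+ 2 | mu in
     [set mu : F | mu \notin [:: 0; 1; -1; 3%:R; - 3%:R]]].

Arguments Theta_b F : clear implicits.
Arguments calA F : clear implicits.

(* Main.v *)
(* Put X = (1 + Z) / 2 and Y = 1 + s + 2 t. Up to a constant G_{s,t} becomes a
   quartic in Z whose roots are the sums sqrt A + sqrt B + sqrt C with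
   sqrt A sqrt B sqrt C = Y (Euler's solution of the quartic). Writing A = 1 + a,
   B = 1 + b, C = 1 + c, the triples which occur are those satisfying
   (a + b + c)^2 = 4 (a b + b c + c a), and then s = (a + b + c) / 2 and
   t (1 + s + t) = a b c / 4. This conic is parametrized by
   (a : b : c) = (4 : (mu + 1)^2 : (mu - 1)^2), mu = (b - c) / a, whence
   theta = (a + b + c)^3 / (2 a b c) = 27 + (mu (mu^2 - 9) / (mu^2 - 1))^2.
   If G is a product of two different irreducible quadratics, then A, B, C lie in
   the field and are distinct; together with a b c <> 0 this excludes exactly
   mu = 0, 1, -1, 3, -3.
   Conversely, for given mu, the triples (A, B, C) = (1 + 4 k,
   1 + (mu + 1)^2 k, 1 + (mu - 1)^2 k) whose product is a square form an elliptic
   curve with full rational 2-torsion, and G is a product of two different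
   irreducible quadratics as soon as A, B, C are not all squares, that is, when the
   point is not a double. Such a point exists since doubling on a finite group
   with nontrivial 2-torsion is not surjective. *)
Require Import Defs.
From mathcomp Require Import all_boot all_order all_algebra.
From mathcomp Require Import boolp classical_sets.
From mathcomp Require Import fingroup cyclic finfield ring.

Import GRing.Theory.
Local Open Scope ring_scope.
Local Open Scope classical_set_scope.

(** * Squares in a finite field *)

Definition is_square {F : finFieldType} (x : F) : bool := [exists y, y ^+ 2 == x].

Lemma is_squareP (F : finFieldType) (x : F) :
  reflect (exists y, y ^+ 2 = x) (is_square x).
Proof. by apply: (iffP existsP) => -[y hy]; exists y; apply/eqP. Qed.

Lemma nonsquare_neq0 (F : finFieldType) (x : F) : ~~ is_square x -> x != 0.
Proof.
by apply: contraNneq => ->; apply/is_squareP; exists 0; rewrite expr0n.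
Qed.

Lemma is_square_mull (F : finFieldType) (c x : F) :
  c != 0 -> is_square (c ^+ 2 * x) = is_square x.
Proof.
move=> c0; apply/is_squareP/is_squareP => -[y hy].
  by exists (y / c); rewrite expr_div_n hy mulrAC mulfV ?mul1r // expf_neq0.
by exists (c * y); rewrite exprMn hy.
Qed.

(** In the cyclic unit group the nonsquares are odd powers of a generator, and two odd exponents
    have an even sum. *)
Lemma nonsquare_mul (F : finFieldType) (x y : F) :
  ~~ is_square x -> ~~ is_square y -> is_square (x * y).
Proof.
have /cyclicP[g gen] := field_unit_group_cyclic [set: {unit F}]%G.
have odd_power z : ~~ is_square z -> exists n, z = val g ^+ n.*2.+1.
  move=> nsq; have z0 := nonsquare_neq0 _ _ nsq.
  have uz : z \is a GRing.unit by rewrite unitfE.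
  have /cycleP[n def_n] : FinRing.unit F uz \in <[g]>%g by rewrite -gen inE.
  have def_z : z = val g ^+ n by rewrite -FinRing.val_unitX -def_n.
  exists n./2; rewrite def_z; case: (boolP (odd n)) => odd_n.
    by rewrite -{1}(odd_double_half n) odd_n.
  case/negP: nsq; apply/is_squareP; exists (val g ^+ n./2).
  by rewrite -exprM muln2 even_halfK // def_z.
move=> /odd_power[m ->] /odd_power[n ->]; apply/is_squareP.
exists (val g ^+ (m + n).+1); rewrite -exprM -exprD; congr (_ ^+ _).
by rewrite muln2 doubleS doubleD addSn addnS.
Qed.

(** * Monic quadratics, their discriminants and products *)

Definition quad {F : finFieldType} (a b : F) : {poly F} := 'X^2 + a *: 'X + b%:P.

Lemma quad_polyE (F : finFieldType) (a b : F) : quad a b = Poly [:: b; a; 1].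
Proof.
rewrite /quad /= !cons_poly_def mul0r add0r mulrDl mul1r -expr2.
by rewrite mul_polyC.
Qed.

(** The final entry 1 keeps [Poly] from truncating, so identities between quadratics become
    identities between lists. *)
Lemma quad_seq (F : finFieldType) (a b : F) : quad a b = [:: b; a; 1] :> seq F.
Proof. by rewrite quad_polyE (PolyK (c := 0)) //= oner_neq0. Qed.

Lemma size_quad (F : finFieldType) (a b : F) : size (quad a b) = 3%N.
Proof. by rewrite quad_seq. Qed.

Lemma quad_inj (F : finFieldType) (a b a' b' : F) :
  quad a b = quad a' b' -> a = a' /\ b = b'.
Proof. by move/(congr1 (@polyseq F)); rewrite !quad_seq => -[-> ->]. Qed.

Lemma horner_quad (F : finFieldType) (a b x : F) :
  (quad a b).[x] = x ^+ 2 + a * x + b.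
Proof. by rewrite !hornerE. Qed.

(** A root x makes the discriminant the square of 2x + a, and the quadratic formula gives the
    converse; in degree 2 irreducibility means having no root. *)
Lemma irreducible_quad (F : finFieldType) (a b : F) : 2%:R != 0 :> F ->
  irreducible_poly (quad a b) <-> ~~ is_square (a ^+ 2 - 4%:R * b).
Proof.
move=> two0; split=> [[_ irr]|nsq].
  apply/negP => /is_squareP[d hd].
  have root_x : root (quad a b) ((d - a) / 2%:R).
    rewrite rootE horner_quad; apply/eqP.
    have -> : b = (a ^+ 2 - d ^+ 2) / 4%:R.
      rewrite hd; field.
      by rewrite (_ : 4 = 2 * 2) ?mulf_neq0 //; ring.
    field.
    by rewrite (_ : 4 = 2 * 2) ?mulf_neq0 //; ring.
  have := irr ('X - ((d - a) / 2%:R)%:P); rewrite size_XsubC dvdp_XsubCl => /(_ isT root_x).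
  by move/eqp_size; rewrite size_XsubC size_quad.
apply: cubic_irreducible; first by rewrite size_quad.
move=> x; apply: contra nsq; rewrite rootE horner_quad => /eqP root_x.
apply/is_squareP; exists (2%:R * x + a).
by have -> : b = - (x ^+ 2 + a * x) by [rewrite -[RHS]addr0 -root_x; ring]; ring.
Qed.

Lemma monic_irreducible_quadraticP (F : finFieldType) (p : {poly F}) :
  2%:R != 0 :> F ->
  monic_irreducible_quadratic p <->
    exists a b, p = quad a b /\ ~~ is_square (a ^+ 2 - 4%:R * b).
Proof.
move=> two0; split=> [[mon_p size_p irr_p]|[a [b [-> nsq]]]].
  have def_p : p = quad p`_1 p`_0.
    rewrite quad_polyE -{1}[p]polyseqK; congr Poly.
    move: mon_p size_p; rewrite monicE lead_coefE.
    by case: (polyseq p) => [|? [|? [|? [|]]]] //= /eqP ->.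
  exists p`_1, p`_0; split=> //.
  by apply/(irreducible_quad _ _ _ two0); rewrite -def_p.
split; [|exact: size_quad|exact/(irreducible_quad _ _ _ two0)].
by rewrite monicE lead_coefE quad_seq.
Qed.

Lemma Gpoly_quad_mul (F : finFieldType) (s t a1 b1 a2 b2 : F) :
  Gpoly s t = quad a1 b1 * quad a2 b2 <->
  [/\ a1 + a2 = - 2%:R, b1 + b2 + a1 * a2 = - s,
      a1 * b2 + a2 * b1 = - (2%:R * t) & b1 * b2 = t].
Proof.
have -> : Gpoly s t = Poly [:: t; - (2%:R * t); - s; - 2%:R; 1].
  rewrite /Gpoly /= !cons_poly_def -!mul_polyC; ring.
have -> : quad a1 b1 * quad a2 b2 =
    Poly [:: b1 * b2; a1 * b2 + a2 * b1; b1 + b2 + a1 * a2; a1 + a2; 1].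
  rewrite /quad /= !cons_poly_def -!mul_polyC; ring.
split=> [/(congr1 (@polyseq F))|[-> -> -> ->] //].
by rewrite !(PolyK (c := 0)) ?oner_neq0 //= => -[-> -> -> ->].
Qed.

(** * Points of an elliptic curve that are not doubles *)

(* Otherwise every point P of the curve E : y^2 = (x - e1)(x - e2)(x - e3) has a
   half, and choosing one gives an injection of E into E minus its 2-torsion.
   With u, v, w square roots of x - e1, x - e2, x - e3 such that u v w = y, a
   half of (x, y) has abscissa x + u v + u w + v w. *)
Lemma exists_point_not_doubled (F : finFieldType) (e1 e2 e3 : F) :
  2%:R != 0 :> F -> e1 != e2 -> e1 != e3 -> e2 != e3 ->
  exists x y, y ^+ 2 = (x - e1) * (x - e2) * (x - e3) /\
    ~~ [&& is_square (x - e1), is_square (x - e2) & is_square (x - e3)].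
Proof.
move=> two0 ne12 ne13 ne23.
pose E : {set F * F} :=
  [set P | P.2 ^+ 2 == (P.1 - e1) * (P.1 - e2) * (P.1 - e3)]%SET.
suff [P PE nsq] : exists2 P, P \in E &
    ~~ [&& is_square (P.1 - e1), is_square (P.1 - e2) & is_square (P.1 - e3)].
  by exists P.1, P.2; split=> //; move: PE; rewrite inE => /eqP.
apply/exists_inP; apply: contraT; rewrite negb_exists_in => /forall_inP all_sq.
have [r Hr] : exists r : F * F -> F * F * F, forall P, P \in E ->
    [/\ (r P).1.1 ^+ 2 = P.1 - e1, (r P).1.2 ^+ 2 = P.1 - e2,
        (r P).2 ^+ 2 = P.1 - e3 & (r P).1.1 * (r P).1.2 * (r P).2 = P.2].
  suff: forall P, exists T : F * F * F, P \in E ->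
    [/\ T.1.1 ^+ 2 = P.1 - e1, T.1.2 ^+ 2 = P.1 - e2,
        T.2 ^+ 2 = P.1 - e3 & T.1.1 * T.1.2 * T.2 = P.2] by apply: fin_all_exists.
  move=> P; have [PE|] := boolP (P \in E); last by exists (0, 0, 0).
  have := all_sq P PE; rewrite negbK => /and3P[].
  move=> /is_squareP[u hu] /is_squareP[v hv] /is_squareP[w hw].
  have : (u * v * w) ^+ 2 == P.2 ^+ 2.
    by move: PE; rewrite inE => /eqP ->; rewrite !exprMn hu hv hw.
  rewrite eqf_sqr => /orP[/eqP uvw|/eqP uvw]; first by exists (u, v, w).
  by exists (- u, v, w); rewrite /= sqrrN !mulNr uvw opprK.
(* The new abscissa minus [e1], [e2], [e3] gives (u + v)(u + w), (u + v)(v + w), (u + w)(v + w), so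
   the new point lies on the curve. *)
pose half P := let: (u, v, w) := r P in
  (u ^+ 2 + e1 + u * v + u * w + v * w, (u + v) * (u + w) * (v + w)).
have addr_neq0 (a b e e' x : F) : e != e' -> a ^+ 2 = x - e -> b ^+ 2 = x - e' ->
    a + b != 0.
  move=> ne ha hb; apply: contraNneq ne => ab0; apply/eqP.
  have : a ^+ 2 - b ^+ 2 = 0 by rewrite subr_sqr ab0 mulr0.
  rewrite ha hb opprB addrC subrKA => /eqP; rewrite subr_eq0 => /eqP //.
have halfE P : P \in E -> half P \in E :\ (e1, 0).
  move=> /Hr; rewrite /half; case: (r P) => [[u v] w] /= [hu hv hw _].
  have uv0 := addr_neq0 _ _ _ _ _ ne12 hu hv.
  have uw0 := addr_neq0 _ _ _ _ _ ne13 hu hw.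
  have vw0 := addr_neq0 _ _ _ _ _ ne23 hv hw.
  rewrite !inE /= xpair_eqE !mulf_eq0 !(negbTE uv0, negbTE uw0, negbTE vw0) andbF /=.
  have -> : e2 = u ^+ 2 + e1 - v ^+ 2 by rewrite hu hv; ring.
  have -> : e3 = u ^+ 2 + e1 - w ^+ 2 by rewrite hu hw; ring.
  by apply/eqP; ring.
(* Equal halves give the same products of the sums u + v, u + w, v + w, hence the same sums, and 2
   is invertible. *)
have half_inj : {in E &, injective half}.
  move=> P P' PE PE'; rewrite /half; have := Hr P PE; have := Hr P' PE'.
  case: (r P) => [[u v] w]; case: (r P') => [[u' v'] w'] /=.
  move=> [hu' hv' hw' uvw'] [hu hv hw uvw] [ex ey].
  have uv0 := addr_neq0 _ _ _ _ _ ne12 hu hv.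
  have uw0 := addr_neq0 _ _ _ _ _ ne13 hu hw.
  have vw0 := addr_neq0 _ _ _ _ _ ne23 hv hw.
  have e12 : (u + v) * (u + w) = (u' + v') * (u' + w').
    have -> : (u + v) * (u + w) = u ^+ 2 + e1 + u * v + u * w + v * w - e1 by ring.
    by rewrite ex; ring.
  have e13 : (u + v) * (v + w) = (u' + v') * (v' + w').
    have -> : (u + v) * (v + w) = u ^+ 2 + e1 + u * v + u * w + v * w - (u ^+ 2 + e1 - v ^+ 2) by ring.
    rewrite ex; have -> : u ^+ 2 + e1 - v ^+ 2 = u' ^+ 2 + e1 - v' ^+ 2.
      by rewrite hu hv hu' hv'; ring.
    by ring.
  have evw : v + w = v' + w'.
    by apply: (mulfI (mulf_neq0 uv0 uw0)); rewrite ey e12.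
  have euv : u + v = u' + v' by apply: (mulIf vw0); rewrite e13 evw.
  have euw : u + w = u' + w' by apply: (mulfI uv0); rewrite e12 euv.
  have eu : u = u'.
    apply: (mulfI two0).
    by have -> : 2%:R * u = (u + v) + (u + w) - (v + w) by [ring]; rewrite euv euw evw; ring.
  have ev : v = v' by apply: (addrI u); rewrite euv eu.
  have ew : w = w' by apply: (addrI u); rewrite euw eu.
  rewrite [P]surjective_pairing [P']surjective_pairing -uvw -uvw' -eu -ev -ew.
  by congr pair; apply: (addIr (- e1)); rewrite -hu -hu' eu.
have subE : half @: E \subset E :\ (e1, 0).
  by apply/fintype.subsetP => _ /imsetP[P PE ->]; apply: halfE.
have := subset_leq_card subE; rewrite card_in_imset // (cardsD1 (e1, 0) E).
by rewrite inE /= subrr !mul0r expr0n eqxx ltnn.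
Qed.

(** * Symmetric functions of the triple and the conic *)

Lemma natr4_neq0 (F : fieldType) : 2%:R != 0 :> F -> 4%:R != 0 :> F.
Proof. by move=> two0; rewrite (natrM _ 2 2) mulf_neq0. Qed.

(** The elementary symmetric functions of A, B, C are 3 + 2s, s^2 + 4s + 3 and (1 + s + 2t)^2, so
    the right side is (1 + s + 2t)^2 - (1 + s)^2. *)
Lemma Omega_product_symmetric (F : finFieldType) (s t A B C Y : F) : 2%:R != 0 :> F ->
  Y ^+ 2 = A * B * C -> Y = 1 + s + 2%:R * t -> A + B + C = 3%:R + 2%:R * s ->
  (A + B + C) ^+ 2 - 4%:R * (A * B + B * C + C * A) = - (3%:R + 4%:R * s) ->
  4%:R * (t * (1 + s + t)) = (A - 1) * (B - 1) * (C - 1).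
Proof.
move=> two0 hY defY hS hS2.
have -> : (A - 1) * (B - 1) * (C - 1)
    = A * B * C - (A * B + B * C + C * A) + (A + B + C) - 1 by ring.
apply: (mulfI (natr4_neq0 _ two0)).
have -> : 4%:R * (A * B * C - (A * B + B * C + C * A) + (A + B + C) - 1) =
  4%:R * (A * B * C) + ((A + B + C) ^+ 2 - 4%:R * (A * B + B * C + C * A))
   - (A + B + C) ^+ 2 + 4%:R * (A + B + C) - 4%:R by ring.
by rewrite hS2 hS -hY defY; ring.
Qed.

(** The relation amounts to (b - c - a)^2 = 4ca, which expresses b and c through a and mu. Here c <>
    0 and b <> 0 exclude mu = 1 and -1, while a <> c, a <> b, b <> c exclude 3, -3, 0. *)
Lemma theta_parametrization (F : finFieldType) (a b c : F) : 2%:R != 0 :> F ->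
  (a + b + c) ^+ 2 = 4%:R * (a * b + b * c + c * a) ->
  [&& a != 0, b != 0, c != 0, a != b, a != c & b != c] ->
  exists2 mu : F, mu \notin [:: 0; 1; -1; 3%:R; - 3%:R] &
    (a + b + c) ^+ 3 / (2%:R * a * b * c) =
    27%:R + (mu * (mu ^+ 2 - 9%:R) / (mu ^+ 2 - 1)) ^+ 2.
Proof.
move=> two0 rel /and5P[a0 b0 c0 ab /andP[ac bc]].
have four0 := natr4_neq0 _ two0.
pose mu := (b - c) / a.
have def_bc : b - c = mu * a by rewrite /mu divfK.
have def_c : 4%:R * c = (mu - 1) ^+ 2 * a.
  apply: (mulIf a0).
  have -> : (mu - 1) ^+ 2 * a * a = (mu * a - a) ^+ 2 by ring.
  rewrite -def_bc.
  have -> : (b - c - a) ^+ 2 = (a + b + c) ^+ 2 - 4%:R * (a * b + b * c + c * a) + 4%:R * c * a by ring.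
  by rewrite rel subrr add0r.
have def_b : 4%:R * b = (mu + 1) ^+ 2 * a.
  have -> : 4%:R * b = 4%:R * (b - c) + 4%:R * c by ring.
  by rewrite def_bc def_c; ring.
have mu1 : mu != 1.
  apply: contraNneq c0 => h; rewrite -(inj_eq (mulfI four0)) mulr0 def_c h.
  by rewrite subrr expr0n mul0r.
have muN1 : mu != -1.
  apply: contraNneq b0 => h; rewrite -(inj_eq (mulfI four0)) mulr0 def_b h.
  by rewrite addNr expr0n mul0r.
have mu_sqr1 : mu ^+ 2 - 1 != 0.
  by rewrite subr_eq0 sqrf_eq1 negb_or mu1.
exists mu.
  rewrite !inE !negb_or mu1 muN1 /= mulf_eq0 invr_eq0 negb_or subr_eq0 bc a0 /=.
  apply/andP; split.
    apply: contraNneq ac => h; rewrite -(inj_eq (mulfI four0)) def_c h.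
    by apply/eqP; ring.
  apply: contraNneq ab => h; rewrite -(inj_eq (mulfI four0)) def_b h.
  by apply/eqP; ring.
have -> : b = (mu + 1) ^+ 2 * a / 4%:R by rewrite -def_b mulrAC mulfV ?mul1r.
have -> : c = (mu - 1) ^+ 2 * a / 4%:R by rewrite -def_c mulrAC mulfV ?mul1r.
by field; rewrite mu_sqr1 four0 a0 two0 subr_eq0 mu1 addr_eq0 muN1.
Qed.

(** * Factors of G built from a triple *)

(* With X = (1 + Z) / 2 the two factors become (Z - al)^2 - (B + C + 2 m) and
   (Z + al)^2 - (B + C - 2 m). *)
Lemma Gpoly_factor (F : finFieldType) (s t al B C m : F) : 2%:R != 0 :> F ->
  m ^+ 2 = B * C -> al * m = 1 + s + 2%:R * t ->
  al ^+ 2 + B + C = 3%:R + 2%:R * s ->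
  (al ^+ 2 + B + C) ^+ 2 - 4%:R * (al ^+ 2 * B + B * C + C * al ^+ 2)
    = - (3%:R + 4%:R * s) ->
  ~~ is_square B -> B != C -> al ^+ 2 != C ->
  product_of_two_distinct_quadratics (Gpoly s t).
Proof.
move=> two0 hm hal hS hS2 nsqB BC alC.
have four0 := natr4_neq0 _ two0.
have B0 := nonsquare_neq0 _ _ nsqB.
(* Since e^2 = BC, one has B(B + C + 2e) = (B + e)^2, nonzero as B <> C: a square discriminant would
   make B a square. *)
have nsq_disc e : e ^+ 2 = m ^+ 2 -> ~~ is_square (B + C + 2%:R * e).
  move=> he; apply: contra nsqB => /is_squareP[d hd].
  have BeE : d ^+ 2 * B = (B + e) ^+ 2.
    by rewrite hd !mulrDl -[C * B]mulrC -hm -he; ring.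
  have Be0 : B + e != 0.
    apply: contraNneq BC => h; have eB : e = - B by rewrite -[e](addKr B) h addr0.
    by apply/eqP; apply: (mulfI B0); rewrite -hm -he eB; ring.
  have d0 : d != 0.
    by apply: contraNneq Be0 => d0; rewrite -sqrf_eq0 -BeE d0 expr0n mul0r.
  apply/is_squareP; exists ((B + e) / d).
  by rewrite expr_div_n -BeE mulrAC mulfV ?mul1r // expf_neq0.
pose a1 := - 1 - al; pose a2 := al - 1.
pose b1 := (a1 ^+ 2 - (B + C + 2%:R * m)) / 4%:R.
pose b2 := (a2 ^+ 2 - (B + C - 2%:R * m)) / 4%:R.
exists (quad a1 b1), (quad a2 b2); split.
- apply/(monic_irreducible_quadraticP _ _ two0); exists a1, b1; split=> //.
  have -> : a1 ^+ 2 - 4%:R * b1 = B + C + 2%:R * m by rewrite /b1; field.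
  exact: nsq_disc.
- apply/(monic_irreducible_quadraticP _ _ two0); exists a2, b2; split=> //.
  have -> : a2 ^+ 2 - 4%:R * b2 = B + C + 2%:R * (- m) by rewrite /b2; field.
  by apply: nsq_disc; rewrite sqrrN.
(* Equal factors force al = m = 0, whence C = 0 = al^2. *)
- apply: contraNneq alC => /quad_inj[a12 b12].
  have al0 : al = 0.
    apply: (mulfI two0); rewrite mulr0.
    by have -> : 2%:R * al = a2 - a1 by [rewrite /a1 /a2; ring]; rewrite a12 subrr.
  have m0 : m = 0.
    apply: (mulfI four0); rewrite mulr0.
    have -> : 4%:R * m = (a1 ^+ 2 - a2 ^+ 2) - 4%:R * (b1 - b2) by rewrite /b1 /b2; field.
    by rewrite a12 b12 !subrr mulr0 subrr.
  move/eqP: hm; rewrite m0 expr0n eq_sym mulf_eq0 (negbTE B0) /= => /eqP ->.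
  by rewrite al0 expr0n.
have sE : s = (al ^+ 2 + B + C - 3%:R) / 2%:R.
  by rewrite hS addrAC subrr add0r mulrAC mulfV ?mul1r.
have tE : t = (al * m - 1 - s) / 2%:R by rewrite hal; field.
apply/Gpoly_quad_mul; split.
- by rewrite /a1 /a2; ring.
- by rewrite sE /b1 /b2 /a1 /a2; field; rewrite two0 four0.
- by rewrite tE sE /b1 /b2 /a1 /a2; field; rewrite two0 four0.
(* The constant coefficient is where the relation [hS2] enters. *)
have E : 16%:R * (b1 * b2) =
    1 - 2%:R * (al ^+ 2 + B + C) + 8%:R * (al * m) +
    ((al ^+ 2 + B + C) ^+ 2 - 4%:R * (al ^+ 2 * B + m ^+ 2 + C * al ^+ 2)).
  by rewrite /b1 /b2 /a1 /a2; field.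
apply: (mulfI (mulf_neq0 four0 four0)); rewrite -natrM E hm hS2 hal hS; ring.
Qed.

(** * From a factorization to the parameter mu *)

Lemma product_of_quadratics_theta (F : finFieldType) (s t : F) : 2%:R != 0 :> F ->
  t * (1 + s + t) != 0 -> product_of_two_distinct_quadratics (Gpoly s t) ->
  exists2 mu : F, mu \notin [:: 0; 1; -1; 3%:R; - 3%:R] &
    theta s t = 27%:R + (mu * (mu ^+ 2 - 9%:R) / (mu ^+ 2 - 1)) ^+ 2.
Proof.
move=> two0 tT0 [p1 [p2 []]].
move=> /(monic_irreducible_quadraticP _ _ two0)[a1 [b1 [-> {p1} nsq1]]].
move=> /(monic_irreducible_quadraticP _ _ two0)[a2 [b2 [-> {p2} nsq2]]] p12.
move=> /Gpoly_quad_mul[h1 h2 h3 h4].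
have four0 := natr4_neq0 _ two0.
have sixteen0 : 16%:R != 0 :> F by rewrite (natrM _ 4 4) mulf_neq0.
set d1 := _ - _ in nsq1; set d2 := _ - _ in nsq2.
have [w hw] := is_squareP _ _ (nonsquare_mul _ _ _ nsq1 nsq2).
(* For square roots r1, r2 of d1, d2 in an extension with r1 r2 = w, B and C are the squares of (r1
   + r2)/2 and (r1 - r2)/2, and m is the product of these two. *)
pose al := - 1 - a1; pose m := (d1 - d2) / 4%:R.
pose A := al ^+ 2; pose B := (d1 + d2 + 2%:R * w) / 4%:R.
pose C := (d1 + d2 - 2%:R * w) / 4%:R.
have def_a2 : a2 = - 2%:R - a1 by rewrite -h1; ring.
have def_s : s = - (b1 + b2 + a1 * a2) by rewrite h2 opprK.
have hS : A + B + C = 3%:R + 2%:R * s.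
  rewrite def_s def_a2 /A /B /C /d1 /d2 def_a2 /al; field.
  by rewrite ?sixteen0 ?four0.
have hm : m ^+ 2 = B * C.
  have -> : B * C = ((d1 + d2) ^+ 2 - 4%:R * w ^+ 2) / 4%:R ^+ 2.
    by rewrite /B /C; field; rewrite ?sixteen0 ?four0 ?two0.
  by rewrite hw /m; field; rewrite ?sixteen0 ?four0 ?two0.
have hal : al * m = 1 + s + 2%:R * t.
  have -> : 2%:R * t = - (a1 * b2 + a2 * b1) by rewrite h3 opprK.
  rewrite def_s def_a2 /m /d1 /d2 def_a2 /al; field.
  by rewrite ?sixteen0 ?four0.
have hS2 : (A + B + C) ^+ 2 - 4%:R * (A * B + B * C + C * A) = - (3%:R + 4%:R * s).
  have -> : A * B + B * C + C * A = A * (d1 + d2) / 2%:R + m ^+ 2.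
    by rewrite hm /B /C; field; rewrite two0 ?sixteen0 ?four0 ?two0.
  have -> : 4%:R * (A * (d1 + d2) / 2%:R + m ^+ 2) =
    2%:R * A * (d1 + d2) + 4%:R * m ^+ 2 by field; rewrite two0 ?sixteen0 ?four0 ?two0.
  have -> : 4%:R * m ^+ 2 = 4%:R * (al - (b1 - b2)) ^+ 2.
    by rewrite /m /d1 /d2 def_a2 /al; field; rewrite ?sixteen0 ?four0 ?two0.
  have -> : 4%:R * (al - (b1 - b2)) ^+ 2
     = 4%:R * (A + (b1 - b2) ^+ 2) - 8%:R * (al * (b1 - b2)) by rewrite /A; ring.
  (* This uses the shape of G: its X-coefficient is -2 times its constant term. *)
  have -> : al * (b1 - b2) = b1 + b2 - 2%:R * (b1 * b2).
    have -> : 2%:R * (b1 * b2) = - (a1 * b2 + a2 * b1) by rewrite h3 h4 opprK.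
    by rewrite def_a2 /al; ring.
  rewrite hS def_s /A /d1 /d2 def_a2 /al; ring.
have eq_abc : 4%:R * (t * (1 + s + t)) = (A - 1) * (B - 1) * (C - 1).
  apply: Omega_product_symmetric two0 _ hal hS hS2.
  by rewrite -mulrA -hm exprMn.
have abc0 : (A - 1) * (B - 1) * (C - 1) != 0 by rewrite -eq_abc mulf_neq0.
(* If A were B or C, then (4A + d1 - d2)^2 = (4 al)^2 d1 would make d1 a square or, when al = 0,
   give d1 = d2 and equal factors. *)
have ne_al w' : w' ^+ 2 = d1 * d2 -> 4%:R * A != d1 + d2 + 2%:R * w'.
  move=> hw'; apply/eqP => eqA.
  have sqE : (4%:R * A + d1 - d2) ^+ 2 = 16%:R * A * d1.
    have -> : (4%:R * A + d1 - d2) ^+ 2 = 4%:R * (d1 ^+ 2 + 2%:R * d1 * w' + w' ^+ 2).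
      by rewrite eqA; ring.
    have -> : 16%:R * A * d1 = 4%:R * d1 * (4%:R * A) by ring.
    by rewrite eqA hw'; ring.
  have [al0|al0] := eqVneq al 0; last first.
    case/negP: nsq1; apply/is_squareP; exists ((4%:R * A + d1 - d2) / (4%:R * al)).
    by rewrite expr_div_n sqE /A; field; rewrite four0 al0 ?sixteen0 ?four0 ?two0.
  case/negP: p12; apply/eqP.
  have a1N : a1 = -1 by rewrite -[a1]opprK -[- a1](addKr (- 1)) -/al al0 addr0 opprK.
  have a12 : a1 = a2 by rewrite def_a2 a1N; ring.
  congr quad => //; apply: (mulfI four0).
  move/eqP: sqE; rewrite {2}/A al0 expr0n mulr0 mul0r sqrf_eq0 /A al0 expr0n mulr0 add0r.
  rewrite /d1 /d2 a12 => /eqP h.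
  by apply/eqP; rewrite -subr_eq0 -oppr_eq0 -h; apply/eqP; ring.
have w0 : w != 0 by rewrite -sqrf_eq0 hw mulf_neq0 ?nonsquare_neq0.
have AB : A != B.
  apply: contraNneq (ne_al w hw) => ->; rewrite /B; apply/eqP; field.
  by rewrite ?sixteen0 ?four0.
have AC : A != C.
  have := ne_al (- w); rewrite sqrrN => /(_ hw); apply: contraNneq => ->.
  by rewrite /C; apply/eqP; field; rewrite ?sixteen0 ?four0 ?two0.
have BC : B != C.
  apply: contraNneq w0 => BC; apply/eqP.
  have -> : w = B - C by rewrite /B /C; field; rewrite ?sixteen0 ?four0 ?two0.
  by rewrite BC subrr.
(* Both sides equal 4s^2. *)
have rel : (A - 1 + (B - 1) + (C - 1)) ^+ 2 =
   4%:R * ((A - 1) * (B - 1) + (B - 1) * (C - 1) + (C - 1) * (A - 1)).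
  have -> : 4%:R * ((A - 1) * (B - 1) + (B - 1) * (C - 1) + (C - 1) * (A - 1)) =
    (A + B + C) ^+ 2 - 8%:R * (A + B + C) + 12%:R
     - ((A + B + C) ^+ 2 - 4%:R * (A * B + B * C + C * A)) by ring.
  rewrite hS2; have -> : A - 1 + (B - 1) + (C - 1) = A + B + C - 3%:R by ring.
  by rewrite hS; ring.
have [] := theta_parametrization _ _ _ _ two0 rel.
  move: abc0; rewrite !mulf_eq0 !negb_or -!andbA => /and3P[-> -> ->].
  by rewrite !(inj_eq (addIr _)) AB AC BC.
move=> mu mu_in eq_mu; exists mu => //; rewrite -{}eq_mu /theta.
have -> : s = (A - 1 + (B - 1) + (C - 1)) / 2%:R.
  have -> : A - 1 + (B - 1) + (C - 1) = 2%:R * s.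
    by rewrite -[2%:R * s](addKr 3%:R) -hS; ring.
  by rewrite mulrAC mulfV ?mul1r.
have -> : t * (1 + (A - 1 + (B - 1) + (C - 1)) / 2%:R + t) =
  (A - 1) * (B - 1) * (C - 1) / 4%:R.
  rewrite -eq_abc [4%:R * _]mulrC mulfK //.
  have -> : A - 1 + (B - 1) + (C - 1) = 2%:R * s.
    by rewrite -[2%:R * s](addKr 3%:R) -hS; ring.
  by rewrite [2%:R * s]mulrC mulfK.
move: abc0; rewrite !mulf_eq0 !negb_or -!andbA => /and3P[A0 B0 C0].
by field; rewrite A0 B0 C0 two0 ?sixteen0 ?four0 ?two0.
Qed.

(** * From a triple, and then from mu, to a factorization *)

(** The triple is reordered to suit [Gpoly_factor]: a nonsquare in the middle and a square al^2
    beside it, with m = (1 + s + 2t) / al when al <> 0. *)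
Lemma Gpoly_product_of_quadratics (F : finFieldType) (s t A B C : F) :
  2%:R != 0 :> F -> (1 + s + 2%:R * t) ^+ 2 = A * B * C ->
  A + B + C = 3%:R + 2%:R * s ->
  (A + B + C) ^+ 2 - 4%:R * (A * B + B * C + C * A) = - (3%:R + 4%:R * s) ->
  A != B -> A != C -> B != C ->
  ~~ [&& is_square A, is_square B & is_square C] ->
  product_of_two_distinct_quadratics (Gpoly s t).
Proof.
move=> two0; move: A B C.
have key A B C : (1 + s + 2%:R * t) ^+ 2 = A * B * C ->
  A + B + C = 3%:R + 2%:R * s ->
  (A + B + C) ^+ 2 - 4%:R * (A * B + B * C + C * A) = - (3%:R + 4%:R * s) ->
  A != C -> B != A -> B != C -> ~~ is_square B ->
  product_of_two_distinct_quadratics (Gpoly s t).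
  move=> hY hS hS2.
  (* A', C' will be A, C in either order, so the hypotheses refer to symmetric functions only. *)
  have square_case A' C' al m : al ^+ 2 = A' -> m ^+ 2 = B * C' ->
      al * m = 1 + s + 2%:R * t -> A' + B + C' = A + B + C ->
      A' * B + B * C' + C' * A' = A * B + B * C + C * A ->
      A' != C' -> B != C' -> ~~ is_square B ->
      product_of_two_distinct_quadratics (Gpoly s t).
    move=> hA hm hal eS eS2 AC BC nsqB.
    by apply: (Gpoly_factor _ _ _ al B C' m) => //; rewrite ?hA ?eS ?eS2.
  have nonzero_square A' C' al : al ^+ 2 = A' -> A' != 0 ->
      (1 + s + 2%:R * t) ^+ 2 = A' * (B * C') -> A' + B + C' = A + B + C ->
      A' * B + B * C' + C' * A' = A * B + B * C + C * A ->
      A' != C' -> B != C' -> ~~ is_square B ->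
      product_of_two_distinct_quadratics (Gpoly s t).
    move=> hA A0 hY'; apply: (square_case A' C' al ((1 + s + 2%:R * t) / al)) => //.
      by rewrite expr_div_n hA hY' mulrAC mulfV ?mul1r.
    by rewrite mulrC divfK // -sqrf_eq0 hA.
  (* Here 1 + s + 2t = 0 and al = 0, so m is taken as a square root of the product of the nonsquares
     B and C'. *)
  have zero A' C' : A' = 0 -> ~~ is_square C' ->
      (1 + s + 2%:R * t) ^+ 2 = A' * (B * C') -> A' + B + C' = A + B + C ->
      A' * B + B * C' + C' * A' = A * B + B * C + C * A ->
      A' != C' -> B != C' -> ~~ is_square B ->
      product_of_two_distinct_quadratics (Gpoly s t).
    move=> A0 nsqC hY' eS eS2 AC BC nsqB.
    have [m hm] := is_squareP _ _ (nonsquare_mul _ _ _ nsqB nsqC).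
    apply: (square_case A' C' 0 m) => //; first by rewrite A0 expr0n.
    by move/eqP: hY'; rewrite A0 !mul0r sqrf_eq0 => /eqP.
  move=> AC BA BC nsqB.
  have [sqA|nsqA] := boolP (is_square A); have [sqC|nsqC] := boolP (is_square C).
  (* If A = 0, then C is a nonzero square and takes its place. *)
  - have [A0|A0] := eqVneq A 0.
      have [al hC] := is_squareP _ _ sqC.
      apply: (nonzero_square C A al) => //; rewrite -?A0 1?eq_sym //.
      + by rewrite hY; ring.
      + by ring.
      + by ring.
    have [al hA] := is_squareP _ _ sqA.
    by apply: (nonzero_square A C al) => //; rewrite hY mulrA.
  - have [A0|A0] := eqVneq A 0.
      by apply: (zero A C) => //; rewrite hY mulrA.
    have [al hA] := is_squareP _ _ sqA.
    by apply: (nonzero_square A C al) => //; rewrite hY mulrA.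
  - have [C0|C0] := eqVneq C 0.
      apply: (zero C A) => //; rewrite 1?eq_sym //; [rewrite hY|..]; ring.
    have [al hC] := is_squareP _ _ sqC.
    apply: (nonzero_square C A al) => //; rewrite 1?eq_sym //; [rewrite hY|..]; ring.
  (* Three nonsquares cannot occur: AB is a nonzero square and ABC a square, so C would be one. *)
  - have [d hd] := is_squareP _ _ (nonsquare_mul _ _ _ nsqA nsqB).
    case/negP: nsqC; apply/is_squareP; exists ((1 + s + 2%:R * t) / d).
    have AB0 : A * B != 0 by rewrite mulf_neq0 ?nonsquare_neq0.
    by rewrite expr_div_n hd hY mulrAC mulfV ?mul1r.
move=> A B C hY hS hS2 AB AC BC; rewrite !negb_and => /or3P[] nsq.
- by apply: (key B A C) => //; [rewrite hY|rewrite -hS|rewrite -hS2]; ring.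
- by apply: (key A B C) => //; rewrite eq_sym.
- by apply: (key A C B) => //; [rewrite hY|rewrite -hS|rewrite -hS2| |]; rewrite 1?eq_sym //; ring.
Qed.

(** For e = -1/c^2 one has c^2 (k - e) = c^2 k + 1. Taking c = 2, mu + 1, mu - 1 turns a point (k,
    y) of the curve into the triple A, B, C without changing which entries are squares. *)
Lemma exists_quadratics_with_theta (F : finFieldType) (mu : F) : 2%:R != 0 :> F ->
  mu \notin [:: 0; 1; -1; 3%:R; - 3%:R] ->
  exists s t, [/\ t * (1 + s + t) != 0,
    product_of_two_distinct_quadratics (Gpoly s t) &
    theta s t = 27%:R + (mu * (mu ^+ 2 - 9%:R) / (mu ^+ 2 - 1)) ^+ 2].
Proof.
move=> two0; rewrite !inE !negb_or => /and5P[mu0 mu1 muN1 mu3 muN3].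
have four0 := natr4_neq0 _ two0.
(* The excluded mu are those for which two of 4, (mu + 1)^2, (mu - 1)^2 agree or one vanishes. *)
have c2 : mu + 1 != 0 by rewrite addr_eq0.
have c3 : mu - 1 != 0 by rewrite subr_eq0.
have c12 : (mu + 1) ^+ 2 != 2%:R ^+ 2.
  rewrite -subr_eq0 (_ : _ - _ = (mu - 1) * (mu - - 3%:R)); last by ring.
  by rewrite mulf_neq0 // subr_eq0.
have c13 : (mu - 1) ^+ 2 != 2%:R ^+ 2.
  rewrite -subr_eq0 (_ : _ - _ = (mu + 1) * (mu - 3%:R)); last by ring.
  by rewrite mulf_neq0 // subr_eq0.
have c23 : (mu + 1) ^+ 2 != (mu - 1) ^+ 2.
  rewrite -subr_eq0 (_ : _ - _ = 4%:R * mu); last by ring.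
  by rewrite mulf_neq0.
have inj_e (c d : F) : c ^+ 2 != d ^+ 2 -> - (c ^+ 2)^-1 != - (d ^+ 2)^-1.
  by apply: contraNneq => /oppr_inj/invr_inj ->.
have [|||k [y [hy nsq]]] := exists_point_not_doubled F
  (- (2%:R ^+ 2)^-1) (- ((mu + 1) ^+ 2)^-1) (- ((mu - 1) ^+ 2)^-1) two0.
- by rewrite inj_e // eq_sym.
- by rewrite inj_e // eq_sym.
- by rewrite inj_e.
have scale (c : F) : c != 0 -> c ^+ 2 * (k - - (c ^+ 2)^-1) = c ^+ 2 * k + 1.
  by move=> c0; rewrite opprK mulrDr mulfV // expf_neq0.
pose A := 2%:R ^+ 2 * k + 1; pose B := (mu + 1) ^+ 2 * k + 1.
pose C := (mu - 1) ^+ 2 * k + 1.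
have nsqABC : ~~ [&& is_square A, is_square B & is_square C].
  by rewrite /A /B /C -!scale // !is_square_mull.
pose Y := 2%:R * (mu + 1) * (mu - 1) * y.
have hY : Y ^+ 2 = A * B * C.
  by rewrite /Y exprMn hy /A /B /C -!scale //; ring.
(* At k = 0 all of A, B, C would be the square 1. *)
have k0 : k != 0.
  apply: contraNneq nsqABC => k0; rewrite /A /B /C k0 !mulr0 add0r andbb andbb.
  by apply/is_squareP; exists 1; rewrite expr1n.
have ne_lin (c d : F) : c != d -> c * k + 1 != d * k + 1.
  by apply: contraNneq => /addIr/(mulIf k0) ->.
(* s is half of (A - 1) + (B - 1) + (C - 1), and t solves 1 + s + 2t = Y. *)
pose s := (mu ^+ 2 + 3%:R) * k; pose t := (Y - 1 - s) / 2%:R.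
have hYt : 1 + s + 2%:R * t = Y by rewrite [2%:R * t]mulrC divfK //; ring.
have hS : A + B + C = 3%:R + 2%:R * s by rewrite /A /B /C /s; ring.
have hS2 : (A + B + C) ^+ 2 - 4%:R * (A * B + B * C + C * A) = - (3%:R + 4%:R * s).
  by rewrite /A /B /C /s; ring.
have tTE : t * (1 + s + t) = (mu + 1) ^+ 2 * (mu - 1) ^+ 2 * k ^+ 3.
  apply: (mulfI four0).
  rewrite (Omega_product_symmetric F s t A B C Y two0 hY (esym hYt) hS hS2).
  by rewrite /A /B /C; ring.
exists s, t; split.
- by rewrite tTE !mulf_neq0 ?expf_neq0.
- apply: (Gpoly_product_of_quadratics _ _ _ A B C) => //.
  + by rewrite hYt.
  + by apply: ne_lin; rewrite eq_sym.
  + by apply: ne_lin; rewrite eq_sym.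
  + exact: ne_lin.
rewrite /theta tTE /s; field.
by rewrite c2 c3 k0 /= (_ : mu ^+ 2 - 1 = (mu - 1) * (mu + 1)) ?mulf_neq0 //; ring.
Qed.

Theorem theorem6p14 (p k q : nat) (F : finFieldType) (p_prime : prime p)
    (p_ge5 : (5 <= p)%N) (k_gt0 : (0 < k)%N) (q_def : q = (p ^ k)%N)
    (cardF : #|F| = q) :
  Theta_b F = [set 27%:R + a | a in calA F].
Proof.
have pchar_p : p \in [pchar F] by apply: card_finPcharP p_prime; rewrite cardF q_def.
have two0 : 2%:R != 0 :> F.
  by rewrite -(dvdn_pcharf pchar_p) gtnNdvd // (leq_trans _ p_ge5).
apply/seteqP; split=> [_ [[s t] /= [st_in split_st] <-]|_ [_ [mu mu_in <-] <-]].
  have [mu mu_in ->] := product_of_quadratics_theta _ _ _ two0 st_in split_st.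
  by exists ((mu * (mu ^+ 2 - 9%:R) / (mu ^+ 2 - 1)) ^+ 2) => //; exists mu.
have [s [t [st_in split_st <-]]] := exists_quadratics_with_theta _ _ two0 mu_in.
by exists (s, t).
Qed.
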